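(* Let ${\cal T}_{min}$ be the minimum equational graph theory and ${\cal O}_{min}$ the minimum order graph theory. Then (i) ${\cal O}_{min}$ is not r.e.; (ii) ${\cal T}_{min}$ is the intersection of a countable set of equational graph theories none of which is r.e.
   Context: A graph model is ${\cal G}=(G,c_{\cal G})$ with $G$ an infinite set and $c_{\cal G}:G^*\times G\to G$ injective and total ($G^*$ = finite subsets of $G$). $\lambda$-terms are interpreted as subsets of $G$ for $\rho:Var\to{\cal P}(G)$: $x_\rho=\rho(x)$; $(MN)_\rho=\{\alpha:\exists a\subseteq N_\rho\text{ finite},c_{\cal G}(a,\alpha)\in M_\rho\}$; $(\lambda x.M)_\rho=\{c_{\cal G}(a,\alpha):a\in G^*,\alpha\in M_{\rho[x:=a]}\}$. The equational graph theory of ${\cal G}$ is ${\rm Eq}({\cal G})=\{M=N:M_\rho=N_\rho\ \forall\rho\}$ and the order graph theory is ${\rm Ord}({\cal G})=\{M\sqsubseteq N: M_\rho\subseteq N_\rho\ \forall\rho\}$. ${\cal T}_{min}$ and ${\cal O}_{min}$ denote the intersections of all equational (resp. order) graph theories; these are themselves equational (resp. order) graph theories. A theory is r.e. if the set of Gödel numbers of its pairs of terms is r.e. *)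

(* Defs.v *)
From mathcomp Require Import all_boot.
From mathcomp Require Import finmap.
From mathcomp Require Import boolp classical_sets functions cardinality.
From Stdlib Require Cantor.

Set Implicit Arguments.
Unset Strict Implicit.
Unset Printing Implicit Defensive.

Local Open Scope classical_set_scope.

(* Raw named terms: alpha-convertible terms have the same interpretation in
   every graph model, so a graph theory on raw terms is the preimage of the
   corresponding theory on alpha-classes, and alpha-equivalence is decidable. *)
Inductive term : Type :=
| Var of nat
| App of term & term
| Lam of nat & term.

(* The carrier being a choiceType is no restriction under the axiom of choice;
   it gives access to {fset carrier} for the finite subsets. *)
Record graph_model := GraphModel {
  carrier :> choiceType;
  carrier_infinite : infinite_set [set: carrier];
  coding : {fset carrier} * carrier -> carrier;
  coding_inj : injective coding
}.

Fixpoint interp (G : graph_model) (rho : nat -> set G) (M : term) : set G :=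
  match M with
  | Var x => rho x
  | App M N => [set alpha | exists a : {fset G},
      [set` a] `<=` interp rho N /\ interp rho M (coding (a, alpha))]
  | Lam x M => [set beta | exists (a : {fset G}) (alpha : G),
      interp [eta rho with x |-> [set` a]] M alpha /\ beta = coding (a, alpha)]
  end.

(* The pair (M, N) stands for the equation M = N, resp. the inequation
   M <= N. *)
Definition theory := set (term * term).

Definition Eq (G : graph_model) : theory :=
  [set e | forall rho : nat -> set G, interp rho e.1 = interp rho e.2].

Definition Ord (G : graph_model) : theory :=
  [set e | forall rho : nat -> set G, interp rho e.1 `<=` interp rho e.2].

Definition equational_graph_theory (T : theory) : Prop :=
  exists G : graph_model, T = Eq G.

Definition order_graph_theory (T : theory) : Prop :=
  exists G : graph_model, T = Ord G.

Definition Tmin : theory := \bigcap_(T in equational_graph_theory) T.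

Definition Omin : theory := \bigcap_(T in order_graph_theory) T.

(* Partial functions nat^n -> nat are represented by their graphs. *)
Definition pfun (n : nat) := n.-tuple nat -> nat -> Prop.

Fixpoint primrec (n : nat) (f : pfun n) (g : pfun n.+2)
    (v : n.-tuple nat) (m : nat) (y : nat) : Prop :=
  if m is m'.+1
  then exists z, primrec f g v m' z /\ g [tuple of m' :: z :: v] y
  else f v y.

(* Kleene's partial recursive functions. Composition is strict, and in [pr_mu]
   the value [f z] must be defined (and nonzero) for every [z] below the
   minimum. *)
Inductive partial_recursive : forall n : nat, pfun n -> Prop :=
| pr_zero : partial_recursive (fun (_ : 0.-tuple nat) y => y = 0)
| pr_succ : partial_recursive (fun (v : 1.-tuple nat) y => y = (thead v).+1)
| pr_proj n (i : 'I_n) :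
    partial_recursive (fun (v : n.-tuple nat) y => y = tnth v i)
| pr_comp n k (f : pfun k) (g : 'I_k -> pfun n) :
    partial_recursive f -> (forall i, partial_recursive (g i)) ->
    partial_recursive (fun (v : n.-tuple nat) y =>
      exists w : k.-tuple nat, (forall i, g i v (tnth w i)) /\ f w y)
| pr_rec n (f : pfun n) (g : pfun n.+2) :
    partial_recursive f -> partial_recursive g ->
    partial_recursive (fun (v : n.+1.-tuple nat) y =>
      primrec f g [tuple of behead v] (thead v) y)
| pr_mu n (f : pfun n.+1) :
    partial_recursive f ->
    partial_recursive (fun (v : n.-tuple nat) y =>
      f [tuple of y :: v] 0 /\
      forall z, z < y -> exists m, f [tuple of z :: v] m.+1).

Definition re (A : set nat) : Prop :=
  exists2 f : pfun 1, partial_recursive f &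
    A = [set n | exists y, f [tuple n] y].

(* Cantor.to_nat : nat * nat -> nat is a bijection; the residue mod 3 tells the
   head constructor, so [godel] is also a bijection. *)
Fixpoint godel (M : term) : nat :=
  match M with
  | Var x => 3 * x
  | App M N => 3 * Cantor.to_nat (godel M, godel N) + 1
  | Lam x M => 3 * Cantor.to_nat (x, godel M) + 2
  end.

Definition re_theory (T : theory) : Prop :=
  re [set Cantor.to_nat (godel e.1, godel e.2) | e in T].

(* Main.v *)
(** A closed program D is built by diagonalization: it looks for a proof in the
    given r.e. theory that D is related to one of finitely many terms, and
    becomes the identity as soon as it finds one.  Its main loop is run by the
    combinator V = ZZ with V s = s V, whose argument in round N pushes N
    identities on the argument stack before passing to round N+1.

    The point is what a non-halting loop can denote in an arbitrary graph model.
    If alpha belongs to V s, then it already belongs to X s for some finite part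
    X of V satisfying X y <= y X for all y.  Round N yields N+1 elements r_0 =
    c(x, alpha), r_(j+1) = c(y_j, r_j) of X; for N large two of them coincide,
    and injectivity of the coding c then forces alpha = r_m for some m.  Hence
    alpha belongs to V, and alpha is cyclic: it is obtained from itself by
    c(y_m, ... c(y_1, alpha)).

    For (i), the search for "D <= V" in O_min is contradictory in both cases.
    For (ii), an equation refuted in some graph model G is refuted in the
    completion of a finite part of G; such a completion has finitely many cyclic
    elements, so non-halting loops have finitely many possible denotations
    there, and D looks for an equality with one of them. *)
Require Import Defs.
From mathcomp Require Import all_boot.
From mathcomp Require Import finmap.
From mathcomp Require Import boolp classical_sets functions cardinality.
From Stdlib Require Cantor.

Set Implicit Arguments.
Unset Strict Implicit.
Unset Printing Implicit Defensive.

Local Open Scope classical_set_scope.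

Local Notation "M $ N" := (App M N) (at level 40, left associativity).

(** * Application of sets of points, continuity and beta-conversion *)

Definition app (G : graph_model) (X Y : set G) : set G :=
  [set alpha | exists a : {fset G}, [set` a] `<=` Y /\ X (coding (a, alpha))].

Local Notation "X <*> Y" := (app X Y) (at level 40, left associativity).

Section Semantics.
Variable G : graph_model.
Implicit Types (rho : nat -> set G) (X Y : set G).

Lemma interp_var rho x : interp rho (Var x) = rho x. Proof. by []. Qed.

Lemma interp_app rho M N : interp rho (M $ N) = interp rho M <*> interp rho N.
Proof. by []. Qed.

Lemma app_mono X X' Y Y' : X `<=` X' -> Y `<=` Y' -> X <*> Y `<=` X' <*> Y'.
Proof.
move=> sX sY al [a [aY aX]]; exists a; split; last exact: sX.
exact: subset_trans sY.
Qed.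

Lemma upd_mono rho rho' x X X' :
  X `<=` X' -> (forall y, rho y `<=` rho' y) ->
  forall y, [eta rho with x |-> X] y `<=` [eta rho' with x |-> X'] y.
Proof. by move=> sX h y /=; case: ifP => _; [exact: sX|exact: h]. Qed.

Lemma upd_mono_val rho x X X' : X `<=` X' ->
  forall y, [eta rho with x |-> X] y `<=` [eta rho with x |-> X'] y.
Proof. by move=> sX; apply: upd_mono => // y; exact: subset_refl. Qed.

Lemma interp_mono rho rho' M :
  (forall x, rho x `<=` rho' x) -> interp rho M `<=` interp rho' M.
Proof.
elim: M rho rho' => [x|M IHM N IHN|x M IHM] rho rho' h /=; first exact: h.
  exact: (app_mono (IHM _ _ h) (IHN _ _ h)).
move=> _ [a [al [alM ->]]]; exists a, al; split=> //.
by apply: IHM alM; exact: upd_mono.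
Qed.

Lemma fin_union (Y : set G) (P : G -> {fset G} -> Prop) (b : {fset G}) :
  (forall al a a', [set` a] `<=` [set` a'] -> P al a -> P al a') ->
  (forall al, al \in b -> exists a : {fset G}, [set` a] `<=` Y /\ P al a) ->
  exists a : {fset G}, [set` a] `<=` Y /\ forall al, al \in b -> P al a.
Proof.
move=> Pmono; elim/finSet_rect: b => b IH hb.
case: (fset_0Vmem b) => [->|[be bbe]].
  by exists fset0; split=> [x|x]; rewrite /= in_fset0.
have [a [aY ha]] : exists a : {fset G}, [set` a] `<=` Y /\
    forall al, al \in (b `\ be)%fset -> P al a.
  apply: IH; first exact: fproperD1.
  by move=> al; rewrite in_fsetD1 => /andP[_ /hb].
have [a' [aY' ha']] := hb _ bbe.
exists (a `|` a')%fset; split.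
  by move=> x /=; rewrite in_fsetU => /orP[/aY|/aY'].
move=> al alb; have [->|ne] := eqVneq al be.
  by apply: Pmono ha' => x /=; rewrite in_fsetU => ->; rewrite orbT.
apply: (Pmono _ a); last by apply: ha; rewrite in_fsetD1 ne.
by move=> x /=; rewrite in_fsetU => ->.
Qed.

(** Continuity in one variable: membership of a point has a finite derivation. In an application,
    the finite sets needed by the finitely many points of the argument are united by [fin_union];
    under a binder of [x] itself, the empty set suffices. *)
Lemma interp_cont rho x M alpha : interp rho M alpha ->
  exists a : {fset G},
    [set` a] `<=` rho x /\ interp [eta rho with x |-> [set` a]] M alpha.
Proof.
have upm rho' M' al a a' : [set` a] `<=` [set` a'] ->
    interp [eta rho' with x |-> [set` a]] M' al ->
    interp [eta rho' with x |-> [set` a']] M' al.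
  by move=> saa; apply: interp_mono; exact: upd_mono_val.
elim: M rho alpha => [y|M IHM N IHN|y M IHM] rho alpha.
- rewrite interp_var => al; have [eyx|ne] := eqVneq y x.
    exists [fset alpha]%fset; rewrite interp_var /= eyx eqxx; split.
      by move=> z /=; rewrite in_fset1 => /eqP ->; rewrite -eyx.
    by rewrite /= in_fset1.
  exists fset0; rewrite interp_var /= (negbTE ne); split=> // z /=.
- case=> b [bN bM].
  have [a [aY ha]] := IHM _ _ bM.
  have [a' [aY' ha']] : exists a : {fset G}, [set` a] `<=` rho x /\
      forall al, al \in b -> interp [eta rho with x |-> [set` a]] N al.
    by apply: fin_union => [al a1 a2|al alb]; [exact: upm|apply/IHN/bN].
  exists (a `|` a')%fset; split.
    by move=> z /=; rewrite in_fsetU => /orP[/aY|/aY'].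
  exists b; split.
    move=> z /ha'; apply: upm => z' /=; rewrite in_fsetU => ->.
    by rewrite orbT.
  by apply: upm ha => z' /=; rewrite in_fsetU => ->.
- case=> b [be [beM ->]]; have [eyx|ne] := eqVneq y x.
    exists fset0; split; first by move=> z /=; rewrite in_fset0.
    exists b, be; split=> //; move: beM; apply: interp_mono => z /=.
    by rewrite eyx; case: eqP => _; exact: subset_refl.
  have [a [aY ha]] := IHM _ _ beM.
  exists a; split; first by move: aY; rewrite /= eq_sym (negbTE ne).
  exists b, be; split=> //; move: ha; apply: interp_mono => z /=.
  have [->|_] := eqVneq z y; rewrite ?(negbTE ne); exact: subset_refl.
Qed.

(** Injectivity of the coding makes the pair recovered from a code of the abstraction unique, which
    gives one inclusion by monotonicity; continuity in [x] gives the other. *)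
Lemma beta rho x M X :
  interp rho (Lam x M) <*> X = interp [eta rho with x |-> X] M.
Proof.
apply/seteqP; split=> al.
  case=> a [aX [b [be [beM /coding_inj []]]]] ea eal; subst b be.
  by apply: interp_mono beM; exact: upd_mono_val.
move=> /(@interp_cont _ x) [a [aX h]].
exists a; split; first by move: aX; rewrite /= eqxx.
exists a, al; split=> //; apply: interp_mono h => y /=.
by case: eqP => _; exact: subset_refl.
Qed.

End Semantics.

Arguments interp : simpl never.

(** * Closed terms and their denotations *)

Fixpoint closed_in (s : seq nat) (M : term) : bool :=
  match M with
  | Var x => x \in s
  | M $ N => closed_in s M && closed_in s N
  | Lam x M => closed_in (x :: s) M
  end.

Local Notation closed := (closed_in [::]).

Lemma closed_in_sub s s' M :
  {subset s <= s'} -> closed_in s M -> closed_in s' M.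
Proof.
elim: M s s' => [x|M IHM N IHN|x M IHM] s s' h /=; first exact: h.
  by case/andP=> /IHM-> // /IHN->.
by apply: IHM => y; rewrite !inE => /orP[->|/h->] //; rewrite orbT.
Qed.

Lemma closedW s M : closed M -> closed_in s M.
Proof. exact: closed_in_sub. Qed.

Lemma interp_closed_in (G : graph_model) s M (rho rho' : nat -> set G) :
  closed_in s M -> {in s, rho =1 rho'} -> interp rho M = interp rho' M.
Proof.
elim: M s rho rho' => [x|M IHM N IHN|x M IHM] s rho rho' /=.
- by rewrite !interp_var => xs ->.
- by case/andP=> hM hN h; rewrite !interp_app (IHM _ _ _ hM h) (IHN _ _ _ hN h).
move=> hM h; rewrite /interp -/interp; apply/seteqP.
have e a : interp [eta rho with x |-> [set` a]] M =
           interp [eta rho' with x |-> [set` a]] M.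
  apply: IHM hM _ => y; rewrite inE /=; case: eqP => //= _; exact: h.
by split=> _ [a [al [alM ->]]]; exists a, al; rewrite ?e // -e.
Qed.

(* [locked] keeps [rewrite] from unfolding closed programs. *)
Ltac solve_closed :=
  rewrite /=; repeat (apply/andP; split); first [done | by apply: closedW].

Definition den (G : graph_model) (M : term) : set G :=
  locked (interp (fun=> set0) M).
Arguments den : clear implicits.

Lemma interp_closed (G : graph_model) M (rho : nat -> set G) :
  closed M -> interp rho M = den G M.
Proof. by move=> cM; rewrite /den -lock; apply: interp_closed_in cM _. Qed.

Lemma den_app G M N : den G (M $ N) = den G M <*> den G N.
Proof. by rewrite /den -!lock. Qed.

Lemma den_beta G x M X :
  den G (Lam x M) <*> X = interp [eta (fun=> set0) with x |-> X] M.
Proof. by rewrite /den -lock beta. Qed.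

(** * Numerals, pairs and basic programs *)

Definition zero_tm := locked (Lam 1 (Lam 2 (Var 2))).
(** The numerals are their own primitive recursors: [num n.+1] applied to [X] and [Y] gives
    [X (num n) (num n X Y)]. A step [X] that ignores its second argument makes a case distinction;
    this also gives the predecessor. *)
Definition succ_tm := locked
  (Lam 0 (Lam 1 (Lam 2 (Var 1 $ Var 0 $ (Var 0 $ Var 1 $ Var 2))))).
Definition num n := locked (iter n (App succ_tm) zero_tm).
Definition id_tm := locked (Lam 0 (Var 0)).
Definition pair_tm := locked (Lam 0 (Lam 1 (Lam 2 (Var 2 $ Var 0 $ Var 1)))).
Definition head_tm := locked (Lam 2 (Var 2 $ Lam 0 (Lam 1 (Var 0)))).
Definition tail_tm := locked (Lam 2 (Var 2 $ Lam 0 (Lam 1 (Var 1)))).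
Definition add_tm := locked (Lam 3 (Lam 4 (Var 3 $ Lam 5 succ_tm $ Var 4))).
Definition pred_tm :=
  locked (Lam 0 (Var 0 $ Lam 1 (Lam 2 (Var 1)) $ zero_tm)).

Lemma num0 : num 0 = zero_tm. Proof. by rewrite /num -lock. Qed.

Lemma numS n : num n.+1 = succ_tm $ num n. Proof. by rewrite /num -!lock. Qed.

Lemma closed_zero : closed zero_tm. Proof. by rewrite /zero_tm -lock. Qed.
Lemma closed_succ : closed succ_tm. Proof. by rewrite /succ_tm -lock. Qed.
Lemma closed_id : closed id_tm. Proof. by rewrite /id_tm -lock. Qed.
Lemma closed_pair : closed pair_tm. Proof. by rewrite /pair_tm -lock. Qed.
Lemma closed_head : closed head_tm. Proof. by rewrite /head_tm -lock. Qed.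
Lemma closed_tail : closed tail_tm. Proof. by rewrite /tail_tm -lock. Qed.

Lemma closed_num n : closed (num n).
Proof.
elim: n => [|n IH]; first by rewrite num0 closed_zero.
by rewrite numS /= closedW ?closed_succ.
Qed.

Lemma closed_add : closed add_tm.
Proof. by rewrite /add_tm -lock /= closedW ?closed_succ. Qed.

Lemma closed_pred : closed pred_tm.
Proof. by rewrite /pred_tm -lock /= closedW ?closed_zero. Qed.

#[local] Hint Resolve closed_zero closed_succ closed_id closed_pair closed_head
  closed_tail closed_num closed_add closed_pred : core.

Local Notation closedE :=
  (interp_closed _ closed_zero, interp_closed _ closed_succ,
   interp_closed _ closed_id, interp_closed _ closed_pair,
   interp_closed _ closed_head, interp_closed _ closed_tail,
   interp_closed _ closed_add, interp_closed _ closed_pred).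

Local Notation sem := (den_beta, beta, interp_app, interp_var).

Section Rules.
Variable G : graph_model.
Implicit Types X Y : set G.
Local Notation N n := (den G (num n)).

Lemma succE n : den G succ_tm <*> N n = N n.+1.
Proof. by rewrite numS den_app. Qed.

Lemma num0E X Y : N 0 <*> X <*> Y = Y.
Proof. by rewrite num0 /zero_tm -lock !sem. Qed.

Lemma numSE n X Y : N n.+1 <*> X <*> Y = X <*> N n <*> (N n <*> X <*> Y).
Proof. by rewrite -succE {1}/succ_tm -lock !sem. Qed.

Lemma id_tmE X : den G id_tm <*> X = X.
Proof. by rewrite /id_tm -lock !sem. Qed.

Lemma headE X Y : den G head_tm <*> (den G pair_tm <*> X <*> Y) = X.
Proof. by rewrite /head_tm /pair_tm -!lock !sem. Qed.

Lemma tailE X Y : den G tail_tm <*> (den G pair_tm <*> X <*> Y) = Y.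
Proof. by rewrite /tail_tm /pair_tm -!lock !sem. Qed.

Lemma addE m n : den G add_tm <*> N m <*> N n = N (m + n).
Proof.
have cS : closed (Lam 5 succ_tm) by solve_closed.
rewrite /add_tm -lock !sem /= interp_closed //.
elim: m => [|m IH]; first by rewrite num0E.
by rewrite numSE IH den_beta interp_closed // succE.
Qed.

Lemma predE m : den G pred_tm <*> N m = N m.-1.
Proof.
rewrite /pred_tm -lock !sem /= !interp_closed //.
case: m => [|m] /=; first by rewrite num0E num0.
by rewrite numSE !sem.
Qed.

End Rules.

(** * Partial recursive functions as step-bounded programs *)

Definition enc (G : graph_model) (v : seq nat) : set G :=
  foldr (fun n X => den G pair_tm <*> den G (num n) <*> X) (den G zero_tm) v.

Arguments enc : clear implicits.

Lemma enc_cons G n v :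
  enc G (n :: v) = den G pair_tm <*> den G (num n) <*> enc G v.
Proof. by []. Qed.

Lemma enc_thead G n (v : n.+1.-tuple nat) :
  den G head_tm <*> enc G v = den G (num (thead v)).
Proof. by case/tupleP: v => x v; rewrite enc_cons headE theadE. Qed.

Lemma enc_behead G n (v : n.+1.-tuple nat) :
  den G tail_tm <*> enc G v = enc G [tuple of behead v].
Proof. by case/tupleP: v => x v; rewrite enc_cons tailE. Qed.

Lemma enc_nth G v i : i < size v ->
  den G head_tm <*> iter i (app (den G tail_tm)) (enc G v) =
  den G (num (nth 0 v i)).
Proof.
elim: v i => // x v IH [|i] iv; first by rewrite enc_cons headE.
by rewrite iterSr enc_cons tailE /= -IH.
Qed.

(* The value [y.+1] of [phi v s] means that [f v = y] has been found within
   [s] steps, and the value [0] that nothing has been found yet. *)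
Definition stepwise_definable n (f : pfun n) : Prop :=
  exists (t : term) (phi : n.-tuple nat -> nat -> nat),
  [/\ closed t,
      forall G (v : n.-tuple nat) s, den G t <*> enc G v <*> den G (num s) =
                    den G (num (phi v s)),
      forall v s s' y, s <= s' -> phi v s = y.+1 -> phi v s' = y.+1
    & forall v y, f v y <-> exists s, phi v s = y.+1].

Lemma stepwise_zero : stepwise_definable (fun (_ : 0.-tuple nat) y => y = 0).
Proof.
exists (Lam 0 (Lam 1 (num 1))), (fun _ _ => 1); split.
- by solve_closed.
- by move=> G v s; rewrite !sem interp_closed.
- by [].
- by move=> v y; split=> [->|[_ [<-]]] //; exists 0.
Qed.

Lemma stepwise_succ :
  stepwise_definable (fun (v : 1.-tuple nat) y => y = (thead v).+1).
Proof.
exists (Lam 0 (Lam 1 (succ_tm $ (succ_tm $ (head_tm $ Var 0))))).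
exists (fun v _ => (thead v).+2); split.
- by solve_closed.
- by move=> G v s; rewrite !sem /= !interp_closed // enc_thead !succE.
- by [].
- by move=> v y; split=> [->|[_ [<-]]] //; exists 0.
Qed.

Lemma stepwise_proj n (i : 'I_n) :
  stepwise_definable (fun (v : n.-tuple nat) y => y = tnth v i).
Proof.
exists (Lam 0 (Lam 1 (succ_tm $ (head_tm $ iter i (App tail_tm) (Var 0))))).
exists (fun v _ => (tnth v i).+1); split.
- suff: closed_in [:: 1; 0] (iter i (App tail_tm) (Var 0)).
    by move=> h; solve_closed.
  by elim: (nat_of_ord i) => //= j ->; rewrite closedW.
- move=> G v s; rewrite !sem !closedE.
  have -> rho : interp rho (iter i (App tail_tm) (Var 0)) =
      iter i (app (den G tail_tm)) (rho 0).
    by elim: (nat_of_ord i) => //= j IH; rewrite interp_app IH closedE.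
  by rewrite enc_nth ?size_tuple // (tnth_nth 0) succE.
- by [].
- by move=> v y; split=> [->|[_ [<-]]] //; exists 0.
Qed.

(** All components run with the same bound [s]. The program first tests that each of them has
    answered, and only then runs [tf] on the predecessors of the answers. *)
Lemma stepwise_comp n k (f : pfun k) (g : 'I_k -> pfun n) :
  stepwise_definable f -> (forall i, stepwise_definable (g i)) ->
  stepwise_definable (fun (v : n.-tuple nat) y =>
      exists w : k.-tuple nat, (forall i, g i v (tnth w i)) /\ f w y).
Proof.
move=> [tf [phif [cf semf monof fE]]] /choice[tg] /choice[phig] hg.
pose args := foldr (fun i acc =>
  pair_tm $ (pred_tm $ (tg i $ Var 0 $ Var 1)) $ acc) zero_tm (enum 'I_k).
(* Answer 0 selects [zero_tm]; a positive answer selects [acc], the remaining tests. *)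
pose body := foldr (fun i acc =>
  tg i $ Var 0 $ Var 1 $ Lam 3 (Lam 4 acc) $ zero_tm)
  (tf $ args $ Var 1) (enum 'I_k).
pose w v s := [tuple (phig i v s).-1 | i < k].
pose phi v s := if [forall i, 0 < phig i v s] then phif (w v s) s else 0.
exists (Lam 0 (Lam 1 body)), phi; split.
- have cargs s : 0 \in s -> 1 \in s -> closed_in s args.
    move=> s0 s1; rewrite /args; elim: (enum _) => /= [|i l ->].
      by rewrite closedW.
    by have [ci _ _ _] := hg i; rewrite s0 s1; solve_closed.
  suff cbody s : 0 \in s -> 1 \in s -> closed_in s body by exact: cbody.
  rewrite /body => {body}; elim: (enum _) s => /= [|i l IH] s s0 s1.
    by rewrite cargs // s1; solve_closed.
  have [ci _ _ _] := hg i; rewrite s0 s1 IH ?inE ?s0 ?s1 ?orbT //.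
  by solve_closed.
- move=> G v s; rewrite !den_beta beta.
  have argsE rho : rho 0 = enc G v -> rho 1 = den G (num s) ->
      interp rho args = enc G (w v s).
    move=> h0 h1; rewrite /args /w /=; elim: (enum _) => /= [|i l IH].
      by rewrite interp_closed.
    have [ci semi _ _] := hg i.
    by rewrite !sem IH h0 h1 !closedE (interp_closed _ ci) semi predE.
  suff bodyE (l : seq 'I_k) rho :
      rho 0 = enc G v -> rho 1 = den G (num s) ->
      interp rho (foldr (fun i acc =>
        tg i $ Var 0 $ Var 1 $ Lam 3 (Lam 4 acc) $ zero_tm)
        (tf $ args $ Var 1) l) =
      den G (num (if all (fun i => 0 < phig i v s) l
                  then phif (w v s) s else 0)).
    rewrite bodyE //; congr (den G (num (if _ then _ else _))).
    apply/allP/forallP => [h i|h i _]; last exact: h.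
    by apply: h; rewrite mem_enum.
  elim: l rho => /= [|i l IH] rho h0 h1.
    by rewrite !sem argsE // h1 (interp_closed _ cf) semf.
  have [ci semi _ _] := hg i.
  rewrite !interp_app !interp_var h0 h1 (interp_closed _ ci) closedE semi.
  case: (phig i v s) => [|p] /=; first by rewrite num0E num0.
  by rewrite numSE !beta IH.
- move=> v s s' y ss'; rewrite /phi; case: forallP => // h e.
  have e' i : phig i v s' = phig i v s.
    have [_ _ monoi _] := hg i; have := h i.
    by case ep: (phig i v s) => [|p] // _; exact: monoi ep.
  case: forallP => [_|[]]; last by move=> i; rewrite e'.
  rewrite -(monof _ _ _ _ ss' e); congr phif.
  by apply: eq_from_tnth => i; rewrite !tnth_mktuple e'.
- move=> v y; split.
    case=> u [hu /fE[s0 es0]].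
    have /choice[S hS] i : exists s, phig i v s = (tnth u i).+1.
      by have [_ _ _ gE] := hg i; apply/gE.
    (* By monotonicity in the bound, the maximum serves all the searches at once. *)
    pose s := maxn s0 (\max_i S i).
    have es i : phig i v s = (tnth u i).+1.
      have [_ _ monoi _] := hg i; apply: monoi (hS i).
      by rewrite leq_max (leq_bigmax i) orbT.
    exists s; rewrite /phi; case: forallP => [_|[]]; last first.
      by move=> i; rewrite es.
    have -> : w v s = u.
      by apply: eq_from_tnth => i; rewrite tnth_mktuple es.
    by apply: monof es0; rewrite leq_max leqnn.
  case=> s; rewrite /phi; case: forallP => // h e.
  exists (w v s); split; last by apply/fE; exists s.
  move=> i; have [_ _ _ gE] := hg i; apply/gE; exists s.
  by rewrite tnth_mktuple prednK.
Qed.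

(** The numeral in the first entry of the list drives the recursion. In [step], [Var 2] is the
    predecessor [m], [Var 3] the answer obtained for [m], and [Var 4] the value found when that
    answer is positive; answer 0 propagates. *)
Lemma stepwise_rec n (f : pfun n) (g : pfun n.+2) :
  stepwise_definable f -> stepwise_definable g ->
  stepwise_definable (fun (v : n.+1.-tuple nat) y =>
      primrec f g [tuple of behead v] (thead v) y).
Proof.
move=> [tf [phif [cf semf monof fE]]] [tg [phig [cg semg monog gE]]].
pose step := Lam 2 (Lam 3 (Var 3 $
  Lam 4 (Lam 5 (tg $ (pair_tm $ Var 2 $ (pair_tm $ Var 4 $ (tail_tm $ Var 0)))
                   $ Var 1)) $ zero_tm)).
pose t := Lam 0 (Lam 1
  (head_tm $ Var 0 $ step $ (tf $ (tail_tm $ Var 0) $ Var 1))).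
pose pr (v : n.-tuple nat) s := fix pr m := if m is m'.+1 then
  (if pr m' is z.+1 then phig [tuple of m' :: z :: v] s else 0) else phif v s.
have pr_mono v s s' m y : s <= s' -> pr v s m = y.+1 -> pr v s' m = y.+1.
  move=> ss'; elim: m y => [|m IH] y /=; first exact: monof.
  by case e: (pr v s m) => [|z] //; rewrite (IH z e); exact: monog.
exists t, (fun (v : n.+1.-tuple nat) s => pr [tuple of behead v] s (thead v)).
split.
- by solve_closed.
- move=> G v s; rewrite !den_beta beta.
  rewrite !interp_app !interp_var /= !(interp_closed _ closed_head).
  rewrite !(interp_closed _ closed_tail) (interp_closed _ cf).
  rewrite enc_thead enc_behead semf.
  elim: (thead v) => [|m IH]; first by rewrite num0E.
  rewrite numSE IH /step !beta !interp_app !interp_var /=.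
  case: (pr _ s m) => [|z]; first by rewrite num0E closedE num0.
  rewrite numSE !beta !interp_app !interp_var /= !closedE (interp_closed _ cg).
  by rewrite enc_behead -!enc_cons -semg.
- by move=> v s s' y; exact: pr_mono.
- move=> v y; move: (thead v) [tuple of behead v] => m {}v.
  elim: m y => [|m IH] y; first exact: fE.
  split=> /=.
    case=> z [/IH[s es] /gE[s' es']]; exists (maxn s s').
    rewrite (pr_mono _ _ _ _ _ (leq_maxl s s') es).
    exact: monog (leq_maxr s s') es'.
  case=> s; case e: (pr v s m) => [|z] // e'.
  by exists z; split; [apply/IH; exists s|apply/gE; exists s].
Qed.

(** The bound [s] also serves as fuel: the numeral [s] iterates [step] into a function of the
    candidate [z], with [Var 3] as the continuation. Answer 0 aborts, answer 1 means that [f]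
    vanishes at [z] and returns [z.+1], and a larger answer passes to the next candidate. *)
Lemma stepwise_mu n (f : pfun n.+1) :
  stepwise_definable f ->
  stepwise_definable (fun (v : n.-tuple nat) y =>
      f [tuple of y :: v] 0 /\
      forall z, z < y -> exists m, f [tuple of z :: v] m.+1).
Proof.
move=> [tf [phif [cf semf monof fE]]].
pose step := Lam 2 (Lam 3 (Lam 4 (tf $ (pair_tm $ Var 4 $ Var 0) $ Var 1 $
  Lam 5 (Lam 6 (Var 5 $ Lam 7 (Lam 8 (Var 3 $ (succ_tm $ Var 4)))
                      $ (succ_tm $ Var 4))) $ zero_tm))).
pose t := Lam 0 (Lam 1 (Var 1 $ step $ Lam 4 zero_tm $ zero_tm)).
pose srch (v : n.-tuple nat) s := fix srch j z := if j is j'.+1 then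
  match phif [tuple of z :: v] s with
  | 0 => 0 | 1 => z.+1 | _ => srch j' z.+1 end else 0.
have srch_mono v s s' j j' z y : s <= s' -> j <= j' ->
    srch v s j z = y.+1 -> srch v s' j' z = y.+1.
  move=> ss'; elim: j j' z => [|j IH] [|j'] z //=; rewrite ltnS => jj'.
  case e: (phif _ s) => [|p] //; rewrite (monof _ _ _ _ ss' e).
  by case: p {e} => // _; exact: IH.
exists t, (fun v s => srch v s s 0); split.
- by solve_closed.
- move=> G v s; rewrite !den_beta beta.
  rewrite !interp_app !interp_var /= (interp_closed _ closed_zero).
  suff H j z : den G (num j) <*> interp [eta [eta fun=> set0 with 0 |->
      enc G v] with 1 |-> den G (num s)] step <*>
      interp [eta [eta fun=> set0 with 0 |-> enc G v] with 1 |-> den G (num s)]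
      (Lam 4 zero_tm) <*> den G (num z) = den G (num (srch v s j z)).
    by have := H s 0; rewrite num0.
  elim: j z => [|j IH] z; first by rewrite num0E beta closedE num0.
  rewrite numSE {1}/step !beta !interp_app !interp_var /= !closedE
    (interp_closed _ cf).
  rewrite -enc_cons (semf G [tuple of z :: v]).
  case: (phif _ s) => [|p]; first by rewrite num0E num0.
  rewrite numSE !beta !interp_app !interp_var /= !closedE succE.
  case: p => [|p]; first by rewrite num0E.
  by rewrite numSE !beta !interp_app !interp_var /= !closedE succE IH.
- by move=> v s s' y ss'; exact: srch_mono.
- move=> v y; split.
    case=> /fE[s0 e0] hz.
    have [s hs] : exists s, forall z, z < y ->
        exists m, phif [tuple of z :: v] s = m.+2.
      elim: (y) hz => [|y' IH] hz; first by exists 0.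
      have [s hs] := IH (fun z zy => hz z (ltnW zy)).
      have [m /fE[s' es']] := hz y' (ltnSn _).
      exists (maxn s s') => z; rewrite ltnS leq_eqVlt => /orP[/eqP ->|/hs].
        by exists m; apply: monof es'; exact: leq_maxr.
      by case=> m' em'; exists m'; apply: monof em'; exact: leq_maxl.
    (* Trying the candidates from 0 to [y] takes [y.+1] units of fuel. *)
    exists (maxn s (maxn s0 y.+1)); set S := maxn _ _.
    have sS : s <= S by exact: leq_maxl.
    have s0S : s0 <= S by rewrite !leq_max leqnn orbT.
    have yS : y.+1 <= S by rewrite !leq_max leqnn !orbT.
    suff H j z : z <= y -> y < z + j -> srch v S j z = y.+1 by exact: H.
    elim: j z => [|j IH] z zy; first by rewrite addn0 ltnNge zy.
    rewrite addnS -addSn => yzj /=.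
    move: zy; rewrite leq_eqVlt => /orP[/eqP ->|zy].
      by rewrite (monof _ _ _ _ s0S e0).
    have [m em] := hs _ zy.
    by rewrite (monof _ _ _ _ sS em) IH.
  case=> s; suff H j z : srch v s j z = y.+1 ->
      [/\ z <= y, phif [tuple of y :: v] s = 1 & forall w, z <= w < y ->
        exists m, phif [tuple of w :: v] s = m.+2].
    move=> /H[_ e h]; split; first by apply/fE; exists s.
    by move=> z zy; have [//|m em] := h z; exists m; apply/fE; exists s.
  elim: j z => // j IH z /=; case e: (phif _ s) => [|[|m]] //.
    by case=> <-; split=> // w; rewrite ltnNge andbN.
  move=> /IH[zy ey h]; split=> //; first exact: ltnW.
  move=> w; rewrite leq_eqVlt => /andP[/orP[/eqP <- _|zw wy]].
    by exists m.
  by apply: h; rewrite zw.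
Qed.

Lemma partial_recursive_stepwise n (f : pfun n) :
  partial_recursive f -> stepwise_definable f.
Proof.
elim=> {n f}.
- exact: stepwise_zero.
- exact: stepwise_succ.
- exact: stepwise_proj.
- by move=> n k f g _ hf _; exact: stepwise_comp.
- by move=> n f g _ hf _; exact: stepwise_rec.
- by move=> n f _; exact: stepwise_mu.
Qed.

(** * Programs computing Gödel numbers, and the search in an r.e. set *)

Definition cantor_tm := locked (Lam 0 (Lam 1 (add_tm $ Var 1 $
  (add_tm $ Var 1 $ Var 0 $
   Lam 2 (Lam 3 (add_tm $ (succ_tm $ Var 2) $ Var 3)) $ zero_tm)))).

Lemma closed_cantor : closed cantor_tm.
Proof. by rewrite /cantor_tm -lock; solve_closed. Qed.

Lemma cantorE G x y :
  den G cantor_tm <*> den G (num x) <*> den G (num y) =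
  den G (num (Cantor.to_nat (x, y))).
Proof.
rewrite /cantor_tm -lock !sem [LHS]/= !closedE addE.
have -> : Cantor.to_nat (x, y) =
  y + nat_rec (fun=> nat) 0 (fun i m => i.+1 + m) (y + x) by [].
rewrite -[RHS]addE; congr (_ <*> _).
have step rho i m : interp rho (Lam 2 (Lam 3
      (add_tm $ (succ_tm $ Var 2) $ Var 3))) <*>
    den G (num i) <*> den G (num m) = den G (num (i.+1 + m)).
  by rewrite !sem /= !closedE succE addE.
elim: (y + x) => [|i IH]; first by rewrite num0E num0.
by rewrite numSE IH step.
Qed.

Definition triple_tm :=
  locked (Lam 0 (add_tm $ Var 0 $ (add_tm $ Var 0 $ Var 0))).

Lemma closed_triple : closed triple_tm.
Proof. by rewrite /triple_tm -lock; solve_closed. Qed.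

Lemma tripleE G x : den G triple_tm <*> den G (num x) = den G (num (3 * x)).
Proof.
by rewrite /triple_tm -lock !sem /= !closedE !addE !mulSn mul0n addn0.
Qed.

Definition godel_app_tm :=
  locked (Lam 0 (Lam 1 (succ_tm $ (triple_tm $ (cantor_tm $ Var 0 $ Var 1))))).

Lemma closed_godel_app : closed godel_app_tm.
Proof.
have h1 := closed_triple; have h2 := closed_cantor.
by rewrite /godel_app_tm -lock; solve_closed.
Qed.

Lemma godel_appE G x y :
  den G godel_app_tm <*> den G (num x) <*> den G (num y) =
  den G (num (3 * Cantor.to_nat (x, y) + 1)).
Proof.
rewrite /godel_app_tm -lock !sem [LHS]/= closedE.
rewrite (interp_closed _ closed_triple) (interp_closed _ closed_cantor).
by rewrite cantorE tripleE succE addn1.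
Qed.

Definition godel_num_tm := locked (Lam 0 (Var 0 $
  Lam 1 (godel_app_tm $ num (godel succ_tm)) $ num (godel zero_tm))).

Lemma closed_godel_num : closed godel_num_tm.
Proof.
have h := closed_godel_app.
by rewrite /godel_num_tm -lock; solve_closed.
Qed.

Lemma godel_numE G n :
  den G godel_num_tm <*> den G (num n) = den G (num (godel (num n))).
Proof.
have cg : closed (Lam 1 (godel_app_tm $ num (godel succ_tm))).
  by have h := closed_godel_app; solve_closed.
rewrite /godel_num_tm -lock !sem [LHS]/=.
rewrite (interp_closed _ cg) (interp_closed _ (closed_num _)).
elim: n => [|n IH]; first by rewrite num0E num0.
rewrite numSE IH den_beta interp_app (interp_closed _ closed_godel_app).
by rewrite (interp_closed _ (closed_num _)) godel_appE numS.
Qed.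

(* The code of the pair [(M $ num (godel M), N)], for [n = godel M] and
   [g = godel N]. *)
Definition self_code n g :=
  Cantor.to_nat (3 * Cantor.to_nat (n, godel (num n)) + 1, g).

Definition self_code_tm g := locked (Lam 0 (cantor_tm $
  (godel_app_tm $ Var 0 $ (godel_num_tm $ Var 0)) $ num g)).

Lemma closed_self_code g : closed (self_code_tm g).
Proof.
have h1 := closed_godel_app; have h2 := closed_godel_num.
have h3 := closed_cantor.
by rewrite /self_code_tm -lock; solve_closed.
Qed.

Lemma self_codeE G n g :
  den G (self_code_tm g) <*> den G (num n) = den G (num (self_code n g)).
Proof.
rewrite /self_code_tm -lock !sem [LHS]/=.
rewrite (interp_closed _ closed_cantor) (interp_closed _ closed_godel_app).
rewrite (interp_closed _ closed_godel_num) (interp_closed _ (closed_num _)).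
by rewrite godel_numE godel_appE cantorE.
Qed.

(** The searches for the several targets are run with the same bound [s], one after the other, by
    induction on [gs]. The answer depends only on [n] and [s], not on the model. *)
Lemma re_search (A : set nat) (gs : seq nat) : re A ->
  exists (H : term) (hit : nat -> nat -> nat),
  [/\ closed H,
      forall G n s, den G H <*> den G (num n) <*> den G (num s) =
                    den G (num (hit n s))
    & forall n, (exists s, 0 < hit n s) <->
                (exists2 g, g \in gs & A (self_code n g))].
Proof.
case=> f /partial_recursive_stepwise [t [phi [ct semt _ fE]]] ->.
elim: gs => [|g gs [H [hit [cH semH hitE]]]].
  exists (Lam 0 (Lam 1 zero_tm)), (fun _ _ => 0); split.
  - by solve_closed.
  - by move=> G n s; rewrite !sem closedE num0.
  - by move=> n; split=> -[].
have cS := closed_self_code g.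
exists (Lam 0 (Lam 1 (t $ (pair_tm $ (self_code_tm g $ Var 0) $ zero_tm) $ Var 1
  $ Lam 2 (Lam 3 (num 1)) $ (H $ Var 0 $ Var 1)))).
exists (fun n s =>
  if phi [tuple self_code n g] s is _.+1 then 1 else hit n s); split.
- by solve_closed.
- move=> G n s; rewrite !den_beta beta !interp_app !interp_var /= !closedE.
  rewrite (interp_closed _ ct) (interp_closed _ cH) (interp_closed _ cS).
  rewrite self_codeE (semt G [tuple self_code n g]).
  case: (phi _ s) => [|y]; first by rewrite num0E semH.
  by rewrite numSE !beta interp_closed.
- move=> n; split.
    case=> s; case e: (phi _ s) => [|y] hs.
      have [|g' g'gs Ag'] := (hitE n).1; first by exists s.
      by exists g' => //; rewrite inE g'gs orbT.
    by exists g; [rewrite mem_head|exists y; apply/fE; exists s].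
  case=> g'; rewrite inE => /orP[/eqP -> [y /fE[s es]]|g'gs Ag'].
    by exists s; rewrite es.
  have [s hs] : exists s, 0 < hit n s by apply/hitE; exists g'.
  by exists s; case: (phi _ s).
Qed.

(** * Loops driven by [loop_tm], and the diagonal program *)

(* [flip_tm] and [loop_tm] are the Z and V of the introduction. *)
Definition flip_tm := locked (Lam 0 (Lam 1 (Var 1 $ (Var 0 $ Var 0)))).
Definition loop_tm := flip_tm $ flip_tm.

Lemma closed_flip : closed flip_tm.
Proof. by rewrite /flip_tm -lock. Qed.

Lemma closed_loop : closed loop_tm.
Proof. by rewrite /= closed_flip. Qed.

Lemma flipE (G : graph_model) (X Y : set G) :
  den G flip_tm <*> X <*> Y = Y <*> (X <*> X).
Proof. by rewrite /flip_tm -lock !sem. Qed.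

Lemma loopE (G : graph_model) (X : set G) :
  den G loop_tm <*> X = X <*> den G loop_tm.
Proof. by rewrite den_app flipE. Qed.

(* [X] is the self-application of a finite part of [flip_tm], large enough for
   producing [alpha]. *)
Lemma loop_finite (G : graph_model) (Y : set G) alpha :
  (den G loop_tm <*> Y) alpha ->
  exists (X : set G) (c : {fset G}),
  [/\ X `<=` [set` c], X `<=` den G loop_tm, (X <*> Y) alpha
    & forall Y', X <*> Y' `<=` Y' <*> X].
Proof.
case=> a [aY]; rewrite den_app => -[b0 [b0F hF]].
(* Adding this code to [b0] puts [coding (a, alpha)] into the self-application of [b]. *)
pose b := (coding (b0, coding (a, alpha)) |` b0)%fset.
have bF : [set` b] `<=` den G flip_tm.
  by move=> th /=; rewrite in_fset1U => /orP[/eqP ->|/b0F].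
(* [g] extracts the second component of a code, with [th] itself as default; the image of [b] under
   [g] bounds the self-application of [b]. *)
pose g th : G := xget th [set de | exists b', th = coding (b', de)].
exists ([set` b] <*> [set` b]), [fset g th | th in b]%fset; split.
- move=> de [b' [_ bde]] /=; apply/imfsetP; exists (coding (b', de)) => //.
  rewrite /g; case: xgetP => [d' _ [b'' /coding_inj []]//|].
  by move/(_ de); case; exists b'.
- exact: app_mono.
- exists a; split=> //; exists b0; split.
    by move=> th /=; rewrite in_fset1U => ->; rewrite orbT.
  by rewrite /= in_fset1U eqxx.
- move=> Y'; rewrite -flipE.
  apply: app_mono; last exact: subset_refl.
  by apply: app_mono; last exact: subset_refl.
Qed.

Definition cyclic (G : graph_model) (alpha : G) : Prop :=
  exists (r : nat -> G) m, [/\ r 0 = alpha, r m.+1 = alpha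
    & forall j, j <= m -> exists y, r j.+1 = coding (y, r j)].

Lemma pigeonhole (T : choiceType) (c : {fset T}) (r : nat -> T) :
  (forall j, j <= #|` c| -> r j \in c) ->
  exists i j, [/\ i < j, j <= #|` c| & r i = r j].
Proof.
move=> rc; set N := #|` c|.
have /negP : ~ uniq (map r (iota 0 N.+1)).
  move=> u; have := uniq_leq_size u (s2 := c); rewrite size_map size_iota.
  rewrite ltnn => H; suff: false by []; apply: H => _ /mapP[j + ->].
  by rewrite mem_iota ltnS => /= /rc.
case/(uniqPn (r 0)) => i [j [ij]]; rewrite size_map size_iota => jN.
have iN := ltn_trans ij jN.
rewrite !(nth_map 0) ?size_iota // !nth_iota // => e.
by exists i, j.
Qed.

Section Loops.
Variable G : graph_model.
Implicit Types X Y : set G.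
Local Notation I := (den G id_tm).
Local Notation "X ^I N" := (iter N (fun Z : set G => Z <*> I) X)
  (at level 30).

(** Unfolding the applications one by one yields codes of codes, the last of which lies in [X]. Each
    added first component is a finite part of the identity, so [X <*> I] being included in [X]
    brings membership in [X] back along the chain. *)
Lemma iter_app_id X N beta : (X ^I N) beta -> X <*> I `<=` X ->
  exists r : nat -> G, [/\ r 0 = beta,
    forall j, j < N -> exists y, r j.+1 = coding (y, r j)
  & forall j, j <= N -> X (r j)].
Proof.
move=> + XI; elim: N beta => [|N IH] be /=.
  by exists (fun=> be); split=> // -[].
case=> y [yI /IH[r [r0 rS rX]]].
exists (fun j => if j is j'.+1 then r j' else be); split=> //.
  by case=> [|j] jN; [exists y|exact: rS].
case=> [|j] jN; last exact: rX.
by apply: XI; exists y; split=> //; rewrite -r0; exact: rX.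
Qed.

Lemma loop_nonhalting (T : nat -> set G) alpha :
  (forall N Y, T N <*> Y = Y ^I N <*> T N.+1) ->
  (den G loop_tm <*> T 0) alpha -> den G loop_tm alpha /\ cyclic alpha.
Proof.
move=> TE /loop_finite[X [c [Xc XV XT XE]]].
have XI : X <*> I `<=` X by move=> al /XE; rewrite id_tmE.
have XIN N Y : X ^I N <*> Y `<=` X <*> Y.
  apply: app_mono; last exact: subset_refl.
  elim: N => [|N IH] /=; first exact: subset_refl.
  by apply: subset_trans XI; apply: app_mono; last exact: subset_refl.
have XTN N : (X <*> T N) alpha.
  by elim: N => // N /XE; rewrite TE => /XIN.
have := XTN #|` c|; move/XE; rewrite TE => -[x [_ hx]].
have [r [r0 rS rX]] := iter_app_id hx XI.
have [i [j [ij jN eij]]] := pigeonhole (fun j jN => Xc _ (rX j jN)).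
(* Injectivity strips one code from both sides of [r i = r j] until the smaller index is 0. *)
have {j ij jN eij} [k kN rk] : exists2 k, k < #|` c| & r k.+1 = r 0.
  elim: i j ij jN eij => [|i IH] [|j] // ij jN e; first by exists j.
  apply: (IH j) => //; first exact: ltnW.
  have [y ey] := rS i (ltn_trans (ij : i < j) jN); have [y' ey'] := rS _ jN.
  by move: e; rewrite ey ey' => /coding_inj[].
have [y ey] := rS _ kN.
have rka : r k = alpha by move: rk; rewrite ey r0 => /coding_inj[].
split; first by apply: XV; rewrite -rka; apply: rX; exact: ltnW.
(* Prepending [alpha] to the chain closes the cycle, since [r k] is [alpha]. *)
exists (fun j => if j is j'.+1 then r j' else alpha), k; split=> //.
case=> [|j'] jk; first by exists x.
by apply: rS; exact: leq_trans jk (ltnW kN).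
Qed.

(** [loop_tm] absorbs the pushed identities, since applying it to the identity gives it back. Hence
    its value on [T M] equals that on [T M.+1] as long as round [M] does not halt, and is the
    identity when it does. *)
Lemma loop_halting (T : nat -> set G) (h : pred nat) :
  (forall N Y, T N <*> Y = if h N then I else Y ^I N <*> T N.+1) ->
  (exists N, h N) -> den G loop_tm <*> T 0 = I.
Proof.
move=> TE [N hN].
suff H M : h (N + M) -> den G loop_tm <*> T M = I by apply: H; rewrite addn0.
elim: N M {hN} => [|N IH] M hM; rewrite loopE TE; first by rewrite hM.
case: ifP => // _.
have -> : den G loop_tm ^I M = den G loop_tm.
  by elim: M {hM} => //= M ->; rewrite loopE id_tmE.
by apply: IH; rewrite addnS -addSn.
Qed.

End Loops.

(** [D] is [F] applied to the numeral of its own Gödel number [n], so that [self_code n g] is the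
    code of [D] paired with [g]. *)
Lemma diagonal_term (A : set nat) (gs : seq nat) : re A ->
  exists D : term, closed D /\
  ((exists2 g, g \in gs & A (Cantor.to_nat (godel D, g))) /\
     (forall G, den G D = den G id_tm) \/
   ~ (exists2 g, g \in gs & A (Cantor.to_nat (godel D, g))) /\
     forall G alpha, den G D alpha -> den G loop_tm alpha /\ cyclic alpha).
Proof.
move=> /(re_search gs) [H [hit [cH semH hitE]]].
pose push := Lam 6 (Lam 7 (Var 7 $ id_tm)).
have cpush : closed push by solve_closed.
(* [Var 0] is [W] itself, [Var 1] the number [n], [Var 2] the round and [Var 3] the argument. A hit
   returns the identity; otherwise [push] is iterated on the argument, and the result is applied to
   the next round. *)
pose W := locked (Lam 0 (Lam 1 (Lam 2 (Lam 3 (H $ Var 1 $ Var 2 $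
  Lam 4 (Lam 5 id_tm) $
  (Var 2 $ push $ Var 3 $ (Var 0 $ Var 0 $ Var 1 $ (succ_tm $ Var 2)))))))).
have cW : closed W by rewrite /W -lock; solve_closed.
pose F := Lam 8 (loop_tm $ (W $ W $ Var 8 $ zero_tm)).
have cF : closed F by have cV := closed_flip; solve_closed.
pose n := godel F; exists (F $ num n); split.
  by apply/andP; split; last exact: closed_num.
pose T (G : graph_model) s : set G :=
  den G W <*> den G W <*> den G (num n) <*> den G (num s).
have DE G : den G (F $ num n) = den G loop_tm <*> T G 0.
  rewrite den_app /F den_beta !interp_app interp_var /= !closedE.
  rewrite (interp_closed _ cW) -interp_app (interp_closed _ closed_loop).
  by rewrite /T num0.
have pushE (G : graph_model) s (Y : set G) :
    den G (num s) <*> den G push <*> Y =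
    iter s (fun Z => Z <*> den G id_tm) Y.
  elim: s => [|s IH]; first by rewrite num0E.
  by rewrite numSE IH !sem /= closedE.
have TE (G : graph_model) s (Y : set G) : T G s <*> Y =
    if 0 < hit n s then den G id_tm
    else iter s (fun Z => Z <*> den G id_tm) Y <*> T G s.+1.
  rewrite /T {1}/W -lock !den_beta !beta !interp_app !interp_var /= !closedE.
  rewrite (interp_closed _ cH) (interp_closed _ cpush) semH succE pushE.
  case: (hit n s) => [|p]; first by rewrite num0E.
  by rewrite numSE !beta closedE.
have [ex|nex] := pselect (exists s, 0 < hit n s); [left|right].
  split; first by have /hitE := ex.
  by move=> G; rewrite DE; apply: loop_halting ex => s Y; exact: TE.
split; first by move/hitE.
move=> G al; rewrite DE; apply: loop_nonhalting => s Y; rewrite TE.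
by case: ifP => // hs; case: nex; exists s.
Qed.

(** * Models with finitely many cyclic elements *)

Lemma godel_inj : injective godel.
Proof.
have mod3 i n : i < 3 -> (3 * n + i) %% 3 = i.
  by move=> i3; rewrite mulnC modnMDl modn_small.
have inj3 i m n : 3 * m + i = 3 * n + i -> m = n.
  by move=> /addIn/eqP; rewrite eqn_pmul2l // => /eqP.
have godelV x : godel (Var x) = 3 * x + 0 by rewrite addn0.
have godelA M N :
  godel (M $ N) = 3 * Cantor.to_nat (godel M, godel N) + 1 by [].
have godelL x M : godel (Lam x M) = 3 * Cantor.to_nat (x, godel M) + 2 by [].
elim=> [x|M IHM N IHN|x M IHM] [y|M' N'|y M'];
  rewrite ?godelV ?godelA ?godelL => e; have := congr1 (modn^~ 3) e;
  rewrite /= !mod3 // => _.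
- by move/inj3: e => ->.
- by have [/IHM -> /IHN ->] := Cantor.to_nat_inj _ _ (inj3 _ _ _ e).
- by have [-> /IHM ->] := Cantor.to_nat_inj _ _ (inj3 _ _ _ e).
Qed.

Lemma theory_codeE (T : theory) M N :
  [set Cantor.to_nat (godel e.1, godel e.2) | e in T]
    (Cantor.to_nat (godel M, godel N)) <-> T (M, N).
Proof.
split=> [[[M' N'] T' /Cantor.to_nat_inj[/godel_inj <- /godel_inj <-]]//|h].
by exists (M, N).
Qed.

(** A non-halting [D] denotes a subset of [c], and the targets represent every subset of [c] that a
    closed term denotes, so the search would succeed. A successful search makes the identity denote
    a subset of [c], but it contains infinitely many codes. *)
Lemma not_re_Eq (G : graph_model) (c : {fset G}) :
  (forall alpha : G, cyclic alpha -> alpha \in c) -> ~ re_theory (Eq G).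
Proof.
move=> cyc reG.
pose good (b : {fset G}) T := closed T /\ den G T = [set` b].
have /choice[pick pickE] b :
    exists T', (exists T, good b T) -> good b T'.
  have [[T hT]|nT] := pselect (exists T, good b T).
    by exists T.
  (* A default for sets that no closed term denotes; [gs] filters them out. *)
  by exists (Var 0).
pose gs := [seq godel (pick b) |
  b <- fpowerset c & `[< exists T, good b T >]].
have [D [cD]] := diagonal_term gs reG.
case=> [[[g /mapP[b + ->] Ag] Did]|[nhit hD]].
  rewrite mem_filter fpowersetE => /andP[/asboolP/pickE[_ bE] bc].
  have /= DE := (theory_codeE _ _ _).1 Ag (fun=> set0).
  have idc : den G id_tm `<=` [set` c].
    rewrite -Did /den -lock DE; move: bE; rewrite /den -lock => ->.
    by move=> al /=; exact: (fsubsetP bc).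
  apply: (@carrier_infinite G).
  pose f (be : G) := coding ([fset be]%fset, be).
  have -> : [set: G] = f @^-1` [set` c].
    apply/seteqP; split=> // be _ /=; apply: idc.
    rewrite /id_tm -lock /den -lock; exists [fset be]%fset, be; split=> //=.
    by rewrite interp_var /= in_fset1.
  apply: finite_preimage; last exact: finite_fset.
  by move=> x y _ _ /coding_inj[].
apply: nhit; pose b : {fset G} := [fset x in c | `[< den G D x >]]%fset.
have bE : den G D = [set` b].
  apply/seteqP; split=> x /=; rewrite !inE /=.
    by move=> Dx; apply/andP; split; [apply/cyc/(hD G _ Dx).2|apply/asboolP].
  by case/andP=> _ /asboolP.
have gb : exists T, good b T by exists D.
exists (godel (pick b)).
  apply: map_f; rewrite mem_filter fpowersetE; apply/andP; split.
    exact/asboolP.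
  by apply/fsubsetP => x; rewrite !inE => /andP[].
apply/theory_codeE => rho /=; have [cT TE] := pickE _ gb.
by rewrite !interp_closed // bE TE.
Qed.

(** * Completions of finite partial codings *)

(* A partial injective coding on an initial segment of the naturals, extended
   to a total one whose new values exceed all the components of their
   arguments. *)
Section Completion.
Variables (k : nat) (tab : {fset nat} * nat -> option 'I_k).
Hypothesis tab_small : forall p j, tab p = Some j ->
  p.2 < k /\ forall x, x \in p.1 -> x < k.
Hypothesis tab_inj : forall p q j, tab p = Some j -> tab q = Some j -> p = q.

(** The pickled pair ensures injectivity, the maximum makes the value exceed the components, since a
    Cantor code is at least the sum of its entries, and [k] keeps it clear of the table. *)
Definition fresh (p : {fset nat} * nat) : nat :=
  k + (Cantor.to_nat (choice.pickle p,
    \max_(x <- p.2 :: enum_fset p.1) x)).+1.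

Definition completion p : nat :=
  if tab p is Some j then j : nat else fresh p.

Lemma fresh_gt (p : {fset nat} * nat) (x : nat) :
  x \in p.2 :: enum_fset p.1 -> x < fresh p.
Proof.
move=> xp; rewrite /fresh addnS ltnS.
set m := \max_(_ <- _) _; set c := choice.pickle p.
have xm : x <= m.
  by rewrite /m; have := @leq_bigmax_seq _ _ xpredT id _ xp isT; apply.
have /leP := Cantor.to_nat_non_decreasing c m; rewrite -/(m + c) => mc.
apply: leq_trans (leq_addl _ _); apply: leq_trans mc.
exact: leq_trans xm (leq_addr _ _).
Qed.

Lemma fresh_geq p : k <= fresh p.
Proof. exact: leq_addr. Qed.

Lemma fresh_inj : injective fresh.
Proof.
move=> p q /addnI/succn_inj/Cantor.to_nat_inj[pq _].
exact: (pcan_inj choice.pickleK).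
Qed.

Lemma completion_inj : injective completion.
Proof.
move=> p q; rewrite /completion.
case ep: (tab p) => [i|]; case eq: (tab q) => [j|]; last exact: fresh_inj.
- by move=> /val_inj ij; apply: tab_inj ep _; rewrite ij.
- by move=> e; have := ltn_ord i; rewrite e ltnNge fresh_geq.
- by move=> e; have := ltn_ord j; rewrite -e ltnNge fresh_geq.
Qed.

Definition completed_model : graph_model :=
  GraphModel infinite_nat completion_inj.

(** The table has no entry whose second component is at least [k]. From such a point on, every code
    is fresh, so the chain increases strictly and never returns. *)
Lemma completed_cyclic (alpha : completed_model) : cyclic alpha -> alpha < k.
Proof.
case=> r [m [r0 rm rS]]; rewrite ltnNge; apply/negP => ka.
suff H i : i <= m -> alpha < r i.+1 by have := H _ (leqnn m); rewrite rm ltnn.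
have step be y : k <= be -> be < completion (y, be).
  move=> kb; rewrite /completion; case e: (tab _) => [j|].
    by have [+ _] := tab_small e; rewrite ltnNge kb.
  by apply: fresh_gt; rewrite mem_head.
elim: i => [|i IH] im; have [y ->] := rS _ im; first by rewrite r0; exact: step.
have aj := IH (ltnW im).
exact: (ltn_trans aj (step _ _ (leq_trans ka (ltnW aj)))).
Qed.

End Completion.

(** * Finite parts of a graph model and their completions *)

Lemma interp_hom (G H : graph_model) (h : G -> H) (rho : nat -> set G)
    (rho' : nat -> set H) M alpha :
  (forall a be, h (coding (a, be)) = coding ([fset h x | x in a]%fset, h be)) ->
  (forall x be, rho x be -> rho' x (h be)) ->
  interp rho M alpha -> interp rho' M (h alpha).
Proof.
move=> hc; elim: M rho rho' alpha => [x|M IHM N IHN|x M IHM] rho rho' al hr.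
- exact: hr.
- case=> a [aN aM]; exists [fset h x | x in a]%fset; split.
    by move=> _ /= /imfsetP[y /= ya ->]; apply: IHN hr _; exact: aN.
  by rewrite -hc; apply: IHM hr _.
- case=> a [be [beM ->]]; exists [fset h x | x in a]%fset, (h be).
  split=> //; apply: IHM beM => y ga /=; case: eqP => _; last exact: hr.
  by move=> /= gaa; apply/imfsetP; exists ga.
Qed.

Section FinitePart.
Variables (G : graph_model) (k : nat) (u : nat -> G).
Hypothesis u_inj : forall i j, i < k -> j < k -> u i = u j -> i = j.

(** The coding of [G] restricted to the points [u i] with [i < k], transported to their indices. *)
Definition part_tab (p : {fset nat} * nat) : option 'I_k :=
  if (p.2 < k) && all (fun x => x < k) (enum_fset p.1)
  then [pick j : 'I_k | coding ([fset u x | x in p.1]%fset, u p.2) == u j]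
  else None.

Lemma part_tabP p j : part_tab p = Some j ->
  [/\ p.2 < k, forall x, x \in p.1 -> x < k
    & coding ([fset u x | x in p.1]%fset, u p.2) = u j].
Proof.
rewrite /part_tab; case: ifP => // /andP[p2 /allP p1].
by case: pickP => // i /eqP e [<-].
Qed.

Lemma part_tab_small p j : part_tab p = Some j ->
  p.2 < k /\ forall x, x \in p.1 -> x < k.
Proof. by case/part_tabP. Qed.

Lemma part_tab_inj p q j :
  part_tab p = Some j -> part_tab q = Some j -> p = q.
Proof.
case/part_tabP=> p2 p1 pE /part_tabP[q2 q1].
rewrite -pE => /coding_inj[e1 e2].
case: p q p2 p1 q2 q1 e1 e2 {pE} => [a x] [b y] /= xk ak yk bk ab xy.
congr pair; last by apply: u_inj => //; rewrite xy.
apply/fsetP => z; apply/idP/idP => zin.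
  have : u z \in [fset u x | x in b]%fset.
    by rewrite ab; apply/imfsetP; exists z.
  by case/imfsetP=> z' /= z'b /u_inj ->; auto.
have : u z \in [fset u x | x in a]%fset.
  by rewrite -ab; apply/imfsetP; exists z.
by case/imfsetP=> z' /= z'b /u_inj ->; auto.
Qed.

Definition part_model : graph_model :=
  completed_model part_tab_inj.

Definition part_env (rho : nat -> set G) (x : nat) : set part_model :=
  [set j : nat | j < k /\ rho x (u j)].

(** The homomorphism from the completion back to [G] that extends [u]. A value [m] from [k] on is
    decoded by inverting [fresh]; the test against [completion] ensures that the components are
    below [m], so fuel above [m] suffices. Non-codes go to [u 0]. *)
Fixpoint collapse_rec (f m : nat) : G :=
  if f is f'.+1 then
    if m < k then u m else
    if choice.unpickle
         (Cantor.of_nat (m - k.+1)).1 is Some (a, be) then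
      if completion part_tab (a, be) == m
      then coding ([fset collapse_rec f' x | x in a]%fset, collapse_rec f' be)
      else u 0
    else u 0
  else u 0.

Definition collapse (m : part_model) : G := collapse_rec m.+1 m.

Lemma collapse_recE f f' m :
  m < f -> m < f' -> collapse_rec f m = collapse_rec f' m.
Proof.
elim: f f' m => [|f IH] [|f'] m //; rewrite !ltnS => mf mf' /=.
case: ifP => // mk; case: choice.unpickle => [[a be]|] //.
case: eqP => // e.
have lt x : x \in be :: enum_fset a -> x < m.
  move=> xab; move: mk; rewrite -e /completion; case: part_tab => [j|_].
    by rewrite ltn_ord.
  exact: (@fresh_gt k (a, be)).
congr (coding (_, _)); last first.
  have bm := lt _ (mem_head _ _).
  by apply: IH; [exact: leq_trans mf|exact: leq_trans mf'].
apply: eq_in_imfset => x xa.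
have xm : x < m by apply: lt; rewrite inE xa orbT.
by apply: IH; [exact: leq_trans mf|exact: leq_trans mf'].
Qed.

Lemma collapse_small (m : part_model) : m < k -> collapse m = u m.
Proof. by rewrite /collapse /= => ->. Qed.

Lemma collapse_coding (a : {fset part_model}) (be : part_model) :
  collapse (coding (a, be)) =
  coding ([fset collapse x | x in a]%fset, collapse be).
Proof.
case e: (part_tab (a, be)) => [j|].
  have -> : coding (a, be) = j :> part_model by rewrite /= /completion e.
  rewrite collapse_small //; have [bk ak <-] := part_tabP e.
  rewrite collapse_small //; congr (coding (_, _)).
  by apply: eq_in_imfset => x xa; rewrite collapse_small //; exact: ak.
have ce : coding (a, be) = fresh k (a, be) :> part_model.
  by rewrite /= /completion e.
have lt x : x \in be :: enum_fset a -> x < fresh k (a, be).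
  exact: (@fresh_gt k (a, be)).
rewrite {1}/collapse ce [LHS]/= ltnNge fresh_geq /=.
have -> : fresh k (a, be) - k.+1 = Cantor.to_nat
    (choice.pickle (a, be), \max_(x <- be :: enum_fset a) x).
  by rewrite /fresh addnS subSS addKn.
rewrite Cantor.cancel_of_to choice.pickleK.
case: eqP => [_|[]]; last exact: ce.
congr (coding (_, _)); last by apply: collapse_recE => //; rewrite lt ?mem_head.
apply: eq_in_imfset => x xa; apply: collapse_recE => //.
by rewrite lt // inE xa orbT.
Qed.

(** [collapse] commutes with the codings and carries [part_env rho] into [rho], so it preserves
    interpretations. *)
Lemma part_interp_sub rho M (j : part_model) :
  j < k -> interp (part_env rho) M j -> interp rho M (u j).
Proof.
move=> jk; rewrite -(collapse_small jk); apply: interp_hom.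
  exact: collapse_coding.
by move=> x i [ik]; rewrite collapse_small.
Qed.

End FinitePart.

Arguments part_env {G k u} u_inj rho x.

(** [U] collects the points and codes occurring in one finite derivation of the membership; any
    finite part covering them can replay it. *)
Lemma interp_part (G : graph_model) (rho : nat -> set G) M alpha :
  interp rho M alpha -> exists U : {fset G},
  forall k (u : nat -> G)
    (u_inj : forall i j, i < k -> j < k -> u i = u j -> i = j),
    (forall x, x \in U -> exists2 j, j < k & u j = x) ->
    forall j, j < k -> u j = alpha ->
      interp (part_env u_inj rho) M (j : part_model u_inj).
Proof.
pose covers (U : {fset G}) k (u : nat -> G) :=
  forall x, x \in U -> exists2 j, j < k & u j = x.
have covers_sub (U U' : {fset G}) k u :
  [set` U] `<=` [set` U'] -> covers U' k u -> covers U k u.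
  by move=> s h x /s; exact: h.
(* A code of [G] whose components and value all have indices is already in the table. *)
have codeE k (u : nat -> G)
    (u_inj : forall i j, i < k -> j < k -> u i = u j -> i = j)
    (a : {fset G}) j l :
    (forall x, x \in a -> exists2 j, j < k & u j = x) ->
    j < k -> l < k -> u l = coding (a, u j) ->
    @coding (part_model u_inj)
      ([fset i in iota 0 k | u i \in a]%fset, j) = l.
  move=> ca jk lk ul; rewrite /= /completion.
  have ua : [fset u x | x in [fset i in iota 0 k | u i \in a]]%fset = a.
    apply/fsetP => x; apply/imfsetP/idP => [[i /=]|xa].
      by rewrite !inE => /andP[_ ua] ->.
    have [i ik ux] := ca _ xa; exists i => //=.
    by rewrite !inE /= mem_iota ik ux.
  case e: (part_tab _ _ _) => [l'|].
    have [_ _] := part_tabP e; rewrite ua /= -ul => /u_inj -> //.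
  move: e; rewrite /part_tab /= jk /=.
  have -> : all (fun x => x < k)
      (enum_fset [fset i in iota 0 k | u i \in a]%fset).
    by apply/allP => i; rewrite !inE mem_iota => /andP[/andP[]].
  by case: pickP => // /(_ (Ordinal lk)); rewrite ua /= ul eqxx.
elim: M rho alpha => [x|M IHM N IHN|x M IHM] rho al.
- by move=> xal; exists fset0 => k u u_inj _ j jk uj; split; rewrite //= uj.
- case=> a [aN aM]; have [UM hM] := IHM _ _ aM.
  have [UN [_ hN]] : exists U : {fset G}, [set` U] `<=` [set: G] /\
      forall be, be \in a -> forall k (u : nat -> G)
      (u_inj : forall i j, i < k -> j < k -> u i = u j -> i = j),
      covers U k u -> forall j, j < k -> u j = be ->
      interp (part_env u_inj rho) N (j : part_model u_inj).
    apply: fin_union => [be b b' bb' h k u u_inj cv|be ba].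
      by apply: h; apply: covers_sub cv.
    by have [U hU] := IHN _ _ (aN _ ba); exists U.
  exists (coding (a, al) |` (a `|` (UM `|` UN)))%fset => k u u_inj cv j jk uj.
  have [l lk ul] := cv (coding (a, al)) (fset1U1 _ _).
  have ca : covers a k u.
    by move=> x xa; apply: cv; rewrite !inE xa orbT.
  exists [fset i in iota 0 k | u i \in a]%fset; split.
    move=> i /=; rewrite !inE mem_iota /= => /andP[ik ua].
    apply: (hN _ ua) => //.
    by move=> x xU; apply: cv; rewrite !inE xU !orbT.
  rewrite (codeE _ _ _ _ _ l) // ?uj //.
  apply: hM => //.
  by move=> x xU; apply: cv; rewrite !inE xU !orbT.
- case=> a [be [beM alE]]; have [UM hM] := IHM _ _ beM.
  exists (be |` (a `|` UM))%fset => k u u_inj cv j jk uj.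
  have [l lk ul] := cv be (fset1U1 _ _).
  exists [fset i in iota 0 k | u i \in a]%fset, l; split; last first.
    apply/esym/codeE => //; last by rewrite uj alE ul.
    by move=> y ya; apply: cv; rewrite !inE ya orbT.
  have <- : part_env u_inj [eta rho with x |-> [set` a]] =
      [eta part_env u_inj rho with x |->
        [set` [fset i in iota 0 k | u i \in a]%fset]] :> (nat -> set nat).
    apply/funext => y; rewrite /part_env /=; case: eqP => // _.
    by apply/seteqP; split=> i /=; rewrite !inE mem_iota /= => /andP.
  by apply: hM => // y yU; apply: cv; rewrite !inE yU !orbT.
Qed.

(** Some [alpha] lies in one side only. A finite part covering a derivation keeps its index in that
    side, while [collapse] would carry membership in the other side back to [G]. All cyclic elements
    of the completion lie below the size of the part. *)
Lemma refuting_model (G : graph_model) e : ~ Eq G e ->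
  exists E : graph_model, ~ Eq E e /\ ~ re_theory (Eq E).
Proof.
case: e => M N nE.
have [rho [P [Q [al [PQ alP alQ]]]]] : exists (rho : nat -> set G) P Q alpha,
    [/\ (P, Q) = (M, N) \/ (P, Q) = (N, M),
        interp rho P alpha & ~ interp rho Q alpha].
  apply: contrapT => H; apply: nE => rho /=; apply/seteqP; split=> al h;
    apply: contrapT => h'; apply: H.
    by exists rho, M, N, al; split=> //; left.
  by exists rho, N, M, al; split=> //; right.
have [U hU] := interp_part alP.
pose s := enum_fset (al |` U)%fset; pose u i := nth al s i.
have u_inj i j : i < size s -> j < size s -> u i = u j -> i = j.
  by move=> si sj /eqP; rewrite nth_uniq ?fset_uniq // => /eqP.
have cv x : x \in (al |` U)%fset -> exists2 j, j < size s & u j = x.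
  by move=> xs; exists (index x s); [rewrite index_mem|rewrite /u nth_index].
have [j js uj] := cv al (fset1U1 _ _).
have jP : interp (part_env u_inj rho) P (j : part_model u_inj).
  by apply: hU => // x xU; apply: cv; rewrite !inE xU orbT.
have jQ : ~ interp (part_env u_inj rho) Q (j : part_model u_inj).
  by move=> /(part_interp_sub js); rewrite uj.
exists (part_model u_inj); split.
  move=> /(_ (part_env u_inj rho)) /= E.
  by case: PQ => -[? ?]; subst P Q; apply: jQ; rewrite ?E // -E.
apply: (@not_re_Eq (part_model u_inj) [fset i in iota 0 (size s)]%fset) => i.
move/(completed_cyclic (@part_tab_small _ _ _)).
by rewrite !inE mem_iota.
Qed.

(** * The minimum theories *)

Lemma TminE e : Tmin e <-> forall G, Eq G e.
Proof.
split=> [h G|h _ [G ->]]; last exact: h.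
by apply: h; exists G.
Qed.

Lemma OminE e : Omin e <-> forall G, Ord G e.
Proof.
split=> [h G|h _ [G ->]]; last exact: h.
by apply: h; exists G.
Qed.

(** Without a hit, [D] lies below [loop_tm] in every model, so the search should have succeeded.
    With a hit, the identity lies below [loop_tm]; then the code of the singleton of [be] paired
    with [be] belongs to [loop_tm], and [loopE] turns this into a code of [be] equal to [be]. *)
Lemma not_re_Omin : ~ re_theory Omin.
Proof.
move=> /(diagonal_term [:: godel loop_tm]) [D [cD]].
have mem1 T : T \in [:: godel loop_tm] <-> T = godel loop_tm.
  by rewrite inE; split=> [/eqP|->].
case=> [[[T /mem1 -> /theory_codeE/OminE h] Did]|[nhit hD]]; last first.
  apply: nhit; exists (godel loop_tm); first exact/mem1.
  apply/theory_codeE/OminE => G rho /= al.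
  by rewrite !interp_closed ?closed_loop // => /hD[].
(* The completion of the empty table has no cyclic element, as none is below 0. *)
pose E : graph_model := @completed_model 0 (fun=> None) ltac:(by []).
have : den E D `<=` den E loop_tm.
  by have := h E (fun=> set0); rewrite /= !interp_closed ?closed_loop.
have nocyc (alpha : E) : ~ cyclic alpha.
  by move=> /completed_cyclic H; have := H ltac:(by []).
pose be : E := 0.
rewrite Did => idL.
have : den E loop_tm (coding ([fset be]%fset, be)).
  apply: idL; rewrite /id_tm -lock /den -lock; exists [fset be]%fset, be.
  by split=> //; rewrite interp_var /= in_fset1.
move=> bL.
have : (den E loop_tm <*> [set` [fset be]%fset]) be.
  by exists [fset be]%fset; split; first exact: subset_refl.
rewrite loopE => -[v [_ /=]]; rewrite in_fset1 => /eqP vE.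
by apply: (nocyc be); exists (fun=> be), 0; split=> // j _; exists v.
Qed.

Theorem theorem10 :
  ~ re_theory Omin /\
  exists S : set theory,
    [/\ countable S,
        forall T : theory, S T -> equational_graph_theory T /\ ~ re_theory T
      & Tmin = \bigcap_(T in S) T].
Proof.
split; first exact: not_re_Omin.
(* One model is chosen for each pair outside [Tmin]; there are countably many pairs, by their Gödel
   codes. *)
have /choice[E hE] e : exists E, ~ Tmin e ->
    ~ Eq E e /\ ~ re_theory (Eq E).
  have [Te|nTe] := pselect (Tmin e).
    by exists (@completed_model 0 (fun=> None) ltac:(by [])).
  have [G /refuting_model[H hH]] : exists G, ~ Eq G e.
    by apply: contrapT => H; apply/nTe/TminE => G; apply: contrapT => hG;
      apply: H; exists G.
  by exists H.
exists [set Eq (E e) | e in ~` Tmin]; split.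
- apply: card_le_trans (card_image_le _ _) _; apply/countable_injP.
  exists (fun e => Cantor.to_nat (godel e.1, godel e.2)).
  by move=> [M N] [M' N'] _ _ /Cantor.to_nat_inj[/godel_inj -> /godel_inj ->].
- by move=> _ [e /hE[_ nre] <-]; split=> //; exists (E e).
- apply/seteqP; split=> [e /TminE h _ [e' _ <-]|e h]; first exact: h.
  by apply: contrapT => ne; apply: (hE e ne).1; apply: h; exists e.
Qed.
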